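(* Let $\phi=\{\phi_t\}_{t\in\mathbb{R}}$ be a continuous flow on a compact metric space $(X,d)$. If $Y\subset X$ is closed, then $\bar{\Omega}(Y)$ is the intersection of all strongly stable sets in $X$ which contain $\omega(Y)$, that is $$\bar{\Omega}(Y)=\bigcap\left\{B:\ B \text{ is strongly stable and } \omega(Y)\subseteq B\right\}.$$
   Context: Notation: $\phi_I(S)=\{\phi_t(x): t\in I, x\in S\}$ for $I\subseteq\mathbb{R}$, $S\subseteq X$; $cl$ denotes closure; $d(x,S)=\inf_{s\in S}d(x,s)$ (with $\inf\emptyset=+\infty$). The $\omega$-limit of $S\subseteq X$ is $\omega(S)=\bigcap_{T\ge 0}cl(\phi_{[T,+\infty)}(S))$. Strong chains: given $x,y\in X$, $\varepsilon>0$, $T>0$, a strong $(\varepsilon,T)$-chain from $x$ to $y$ is a finite sequence $(x_i,t_i)_{i=1,\dots,n}\subset X\times\mathbb{R}$ ($n\ge 1$) such that $t_i\ge T$ for all $i$, $x_1=x$ and, setting $x_{n+1}:=y$, $\sum_{i=1}^n d(\phi_{t_i}(x_i),x_{i+1})<\varepsilon$. For $Y\subseteq X$, $\Omega(Y,\varepsilon,T)$ is the set of $x\in X$ such that there is a strong $(\varepsilon,T)$-chain from a point of $Y$ to $x$, and $\bar{\Omega}(Y)=\bigcap_{\varepsilon>0,\,T>0}\Omega(Y,\varepsilon,T)$. Strongly stable set: a closed set $B\subset X$ is strongly stable if there exist $\rho>0$, a family $(U_\eta)_{\eta\in(0,\rho)}$ of closed nested neighborhoods of $B$ (nested: $U_\eta\subseteq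 U_\lambda$ for $\eta<\lambda$) and a function $(0,\rho)\ni\eta\mapsto t(\eta)\in(0,+\infty)$ bounded on compact subsets of $(0,\rho)$, such that (i) for any $0<\eta<\lambda<\rho$, $\{x\in X: d(x,U_\eta)<\lambda-\eta\}\subseteq U_\lambda$; (ii) $B=\bigcap_{\eta\in(0,\rho)}\omega(U_\eta)$; (iii) for any $0<\eta<\rho$, $cl(\phi_{[t(\eta),+\infty)}(U_\eta))\subseteq U_\eta$. *)

(* Defs.v *)
From HB Require Import structures.
From mathcomp Require Import all_boot all_order all_algebra.
From mathcomp Require Import all_classical all_reals all_analysis.

Set Implicit Arguments.
Unset Strict Implicit.
Unset Printing Implicit Defensive.

Import Order.TTheory GRing.Theory Num.Theory.
Import numFieldNormedType.Exports.

Local Open Scope classical_set_scope.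
Local Open Scope ring_scope.

Definition continuous_flow (R : realType) (X : metricType R)
    (phi : R -> X -> X) : Prop :=
  [/\ forall x : X, phi 0 x = x,
      forall (s t : R) (x : X), phi (s + t) x = phi s (phi t x) &
      continuous (fun p : R * X => phi p.1 p.2)].

Definition flow_image (R : realType) (X : metricType R) (phi : R -> X -> X)
    (I : set R) (S : set X) : set X :=
  [set phi t x | t in I & x in S].

Definition omega_limit (R : realType) (X : metricType R) (phi : R -> X -> X)
    (S : set X) : set X :=
  \bigcap_(T in [set T : R | 0 <= T])
    closure (flow_image phi `[T, +oo[%classic S).

(* Valued in [\bar R], so that the distance to the empty set is [+oo]. *)
Definition set_dist (R : realType) (X : metricType R) (x : X) (S : set X) :
    \bar R :=
  ereal_inf [set (mdist x s)%:E | s in S].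

(* The points are indexed from 0: [x_ 0, ..., x_ n.-1] are the points of the
   chain and [x_ n] is its endpoint [y]. The values of [x_] beyond [n] and of
   [t_] from [n] on are irrelevant. *)
Definition strong_chain (R : realType) (X : metricType R) (phi : R -> X -> X)
    (eps T : R) (x y : X) : Prop :=
  exists (n : nat) (x_ : nat -> X) (t_ : nat -> R),
    [/\ (0 < n)%N,
        forall i : nat, (i < n)%N -> T <= t_ i,
        x_ 0%N = x,
        x_ n = y &
        \sum_(i < n) mdist (phi (t_ i) (x_ i)) (x_ i.+1) < eps].

Definition chain_reach (R : realType) (X : metricType R) (phi : R -> X -> X)
    (Y : set X) (eps T : R) : set X :=
  [set x | exists2 y, Y y & strong_chain phi eps T y x].

Definition chain_reach_bar (R : realType) (X : metricType R)
    (phi : R -> X -> X) (Y : set X) : set X :=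
  [set x | forall eps T : R, 0 < eps -> 0 < T -> chain_reach phi Y eps T x].

(* [U] and [t] are total functions whose values matter only on ]0, rho[. *)
Definition strongly_stable (R : realType) (X : metricType R)
    (phi : R -> X -> X) (B : set X) : Prop :=
  closed B /\
  exists (rho : R) (U : R -> set X) (t : R -> R),
    [/\ 0 < rho,
        forall eta : R, 0 < eta < rho -> closed (U eta) /\ set_nbhs B (U eta),
        forall eta lambda : R, 0 < eta -> eta < lambda -> lambda < rho ->
          U eta `<=` U lambda,
        (forall eta : R, 0 < eta < rho -> 0 < t eta) /\
        (forall K : set R, compact K -> K `<=` `]0, rho[%classic ->
          [bounded t eta | eta in K]) &
        [/\ forall eta lambda : R, 0 < eta -> eta < lambda -> lambda < rho ->
              [set x | (set_dist x (U eta) < (lambda - eta)%:E)%E]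
                `<=` U lambda,
            B = \bigcap_(eta in `]0, rho[%classic) omega_limit phi (U eta) &
            forall eta : R, 0 < eta < rho ->
              closure (flow_image phi `[t eta, +oo[%classic (U eta))
                `<=` U eta]].

(* Main.v *)
Require Import Defs.
From HB Require Import structures.
From mathcomp Require Import all_boot all_order all_algebra.
From mathcomp Require Import all_classical all_reals all_analysis.
From mathcomp Require Import lra.

(** Two opposite estimates link strong chains and strongly stable sets.

    Strong chains stay inside stable families.  Let [B] be strongly stable with
    family [U] and let [omega_limit phi Y `<=` B].  By compactness the orbits of
    [Y] enter [U eta0] after some uniform time ([omega_limit_absorb]).  From
    then on, if all flow times are long enough for [phi] to map each [U a] with
    [a] in [[eta0, eta]] into itself, a jump of length [d] costs at most [d] in
    the parameter [a] ([chain_tracking]).  The jumps have total length less than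
    [eta - eta0], so the whole chain stays in [U eta]; as its last jump is short
    and its last flow time is long, its endpoint is almost in a late image of
    [U eta].  Letting the precision go to [0] and the times to infinity puts the
    endpoint in [omega_limit phi (U eta)] ([chain_reach_bar_stable]).

    Strong chains generate stable families.  For fixed [T > 0], the sets
    [closure (chain_reach phi Y eta T)], [eta > 0], satisfy the axioms of strong
    stability: lengthening the last jump of a chain by [d] adds [d] to its cost,
    and appending a flow segment of time at least [T] without jump is free
    ([strongly_stable_reach_core]).  The stable set [reach_core Y T] they define
    contains [omega_limit phi Y], since the orbits of [Y] are chains without
    jumps, and is contained in [chain_reach phi Y eps T] for every [eps > 0].
    Hence the intersection of these stable sets over [T] is contained in
    [chain_reach_bar phi Y]. *)

Set Implicit Arguments.
Unset Strict Implicit.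
Unset Printing Implicit Defensive.

Import Order.TTheory GRing.Theory Num.Theory.
Import numFieldNormedType.Exports.

Local Open Scope classical_set_scope.
Local Open Scope ring_scope.

(** * Closures and distances in metric spaces *)

Lemma closure_mdistP (R : realType) (X : metricType R) (A : set X) (x : X) :
  closure A x <-> forall d : R, 0 < d -> exists2 a, A a & mdist x a < d.
Proof.
split=> [clx d d0|H V /nbhs_ballP[d /= d0 dV]].
  have [a [Aa]] := clx _ (nbhsx_ballx x d d0).
  by rewrite ballEmdist /= => xa; exists a.
have [a Aa xa] := H d d0; exists a; split=> //; apply: dV.
by rewrite ballEmdist.
Qed.

Lemma set_dist_ltP (R : realType) (X : metricType R) (x : X) (A : set X)
    (d : R) :
  (set_dist x A < d%:E)%E <-> exists2 a, A a & mdist x a < d.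
Proof.
split=> [/ereal_inf_lt[_ [a Aa <-]]|[a Aa xa]].
  by rewrite lte_fin => xa; exists a.
apply: (@le_lt_trans _ _ (mdist x a)%:E); last by rewrite lte_fin.
by apply: ereal_inf_lbound; exists a.
Qed.

(** * Limit sets of the flow *)

Section Flow.
Variables (R : realType) (X : metricType R) (phi : R -> X -> X).
Hypothesis hphi : continuous_flow phi.

Let phiD s t x : phi (s + t) x = phi s (phi t x).
Proof. by case: hphi. Qed.

Lemma flow_continuous (t : R) : continuous (phi t).
Proof.
case: hphi => _ _ cphi x.
move=> V /(cphi (t, x))[[A B] /= [tA xB] ABV].
apply: filterS xB => y By; apply: (ABV (t, y)); split=> //.
exact: nbhs_singleton tA.
Qed.

Lemma closure_flow (A B : set X) (t : R) :
  (forall x, A x -> B (phi t x)) ->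
  forall x, closure A x -> closure B (phi t x).
Proof.
move=> AB x clx V /flow_continuous/clx[a [Aa Va]].
by exists (phi t a); split=> //; exact: AB.
Qed.

(** The image of [A] after time [T + T0] is the image of [phi T0 @` A] after
    time [T]. *)
Lemma omega_limit_delay (A B : set X) (T0 : R) :
  0 <= T0 -> (forall x, A x -> B (phi T0 x)) ->
  omega_limit phi A `<=` omega_limit phi B.
Proof.
move=> T00 AB x xA T /= T_ge0.
have := xA (T + T0) (addr_ge0 T_ge0 T00).
apply: closureS => _ [t /= tT [a Aa <-]].
exists (t - T0) => /=.
  by move: tT; rewrite !in_itv /= !andbT => tT; rewrite lerBrDr.
by exists (phi T0 a); [exact: AB | rewrite -phiD subrK].
Qed.

(** Points outside [U] at later and later times would accumulate, by
    compactness, at a point of the limit set, around which there is no room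
    outside [U]. *)
Lemma omega_limit_absorb (A U : set X) :
  compact [set: X] -> set_nbhs (omega_limit phi A) U ->
  exists2 T0 : R, 0 <= T0 & forall t a, T0 <= t -> A a -> U (phi t a).
Proof.
move=> hX AU; apply: contrapT => noT.
have /choice[p pP] (n : nat) : exists p : X,
    flow_image phi `[n%:R, +oo[%classic A p /\ ~ U p.
  apply: contrapT => nop; apply: noT; exists n%:R => // t a nt Aa.
  apply: contrapT => nU; apply: nop; exists (phi t a); split=> //.
  by exists t; [rewrite /= in_itv /= nt | exists a].
have [x [_ px]] := hX (p @ \oo) _ filterT.
have xA : omega_limit phi A x.
  move=> T /= T0 V xV.
  have ptail : (p @ \oo) (flow_image phi `[T, +oo[%classic A).
    apply: filterS (nbhs_infty_ger T) => n /= Tn.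
    have [[t /= + [a Aa <-]] _] := pP n.
    rewrite in_itv /= andbT => nt.
    by exists t; [rewrite /= in_itv /= (le_trans Tn nt) | exists a].
  exact: px ptail xV.
have pnU : (p @ \oo) (~` U) by apply: (@filterE _ \oo) => n; have [] := pP n.
by have [y []] := px _ _ pnU (AU _ xA).
Qed.

(** * Operations on strong chains *)

Lemma strong_chain_weaken (eps eps' T : R) (x y : X) :
  eps <= eps' -> strong_chain phi eps T x y -> strong_chain phi eps' T x y.
Proof.
move=> ee [n [x_ [t_ [n0 tT x0 xn ?]]]].
by exists n, x_, t_; split=> //; exact: lt_le_trans ee.
Qed.

Lemma strong_chain_move (eps d T : R) (x y z : X) :
  strong_chain phi eps T x y -> mdist y z <= d ->
  strong_chain phi (eps + d) T x z.
Proof.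
move=> [[|n] [x_ [t_ []]]] // _ tT x0 xn; rewrite big_ord_recr /= => sumE yz.
exists n.+1, (fun i => if i == n.+1 then z else x_ i), t_.
split=> //; first by rewrite eqxx.
rewrite big_ord_recr /= eqxx (ltn_eqF (ltnSn n)).
under eq_bigr => i _ do
  rewrite eqSS (ltn_eqF (ltn_ord i)) (ltn_eqF (leqW (ltn_ord i))).
have := metric_triangle (phi (t_ n) (x_ n)) (x_ n.+1) z.
by move: sumE yz; rewrite xn; lra.
Qed.

Lemma strong_chain_flow (eps T t : R) (x y : X) :
  T <= t -> strong_chain phi eps T x y -> strong_chain phi eps T x (phi t y).
Proof.
move=> Tt [n [x_ [t_ [n0 tT x0 xn sumE]]]].
exists n.+1, (fun i => if i == n.+1 then phi t y else x_ i),
  (fun i => if i == n then t else t_ i).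
split=> //; last 2 first.
- by rewrite eqxx.
- rewrite big_ord_recr /= !eqxx (ltn_eqF (ltnSn n)) xn mdistxx addr0.
  under eq_bigr => i _ do
    rewrite eqSS !(ltn_eqF (ltn_ord i)) (ltn_eqF (leqW (ltn_ord i))).
  exact: sumE.
move=> i; rewrite ltnS leq_eqVlt; case: eqP => //= _; exact: tT.
Qed.

Lemma strong_chain_orbit (eps T t : R) (x : X) :
  0 < eps -> T <= t -> strong_chain phi eps T x (phi t x).
Proof.
move=> eps0 Tt.
exists 1%N, (fun i => if i == 0%N then x else phi t x), (fun=> t).
by split=> //; rewrite big_ord1 /= mdistxx.
Qed.

(** Following the orbit of the starting point for a time [T0] shortens the first
    flow time, without changing any jump. *)
Lemma strong_chain_delay (eps T0 T : R) (x y : X) :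
  0 <= T0 -> strong_chain phi eps (T0 + T) x y ->
  strong_chain phi eps T (phi T0 x) y.
Proof.
move=> T00 [[|n] [x_ [t_ []]]] // _ tT x0 xn sumE.
exists n.+1, (fun i => if i == 0%N then phi T0 x else x_ i),
  (fun i => if i == 0%N then t_ 0%N - T0 else t_ i).
split=> //.
  by move=> [|i] /tT /=; lra.
move: sumE; rewrite !big_ord_recl /= x0 -phiD subrK.
by under eq_bigr do rewrite /bump /=.
Qed.

(** A jump of length [d] is paid by raising the parameter of the family by [d];
    since thickening a member of the family needs a strict inequality, [x_ m]
    is only claimed to lie in the members of parameter strictly above the cost
    of the first [m] jumps. *)
Lemma chain_tracking (U : R -> set X) (a b M : R) (n : nat)
    (x_ : nat -> X) (t_ : nat -> R) :
  (forall c e, a <= c -> c < e -> e <= b -> U c `<=` U e) ->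
  (forall c e x, a <= c -> c < e -> e <= b ->
     (set_dist x (U c) < (e - c)%:E)%E -> U e x) ->
  (forall c t x, a <= c <= b -> M <= t -> U c x -> U c (phi t x)) ->
  (forall i, (i < n)%N -> M <= t_ i) ->
  U a (x_ 0%N) ->
  forall m, (m <= n)%N -> forall c : R,
    a + \sum_(i < m) mdist (phi (t_ i) (x_ i)) (x_ i.+1) < c -> c <= b ->
    U c (x_ m).
Proof.
move=> Umono Uthick Uinv tM x0; elim=> [|m IH] mn c.
  by rewrite big_ord0 addr0 => ac cb; apply: Umono x0.
rewrite big_ord_recr /=; set s := \sum_(_ < _) _; set d := mdist _ _.
move=> sc cb.
have s0 : 0 <= s by apply: sumr_ge0 => i _; exact: mdist_ge0.
have d0 : 0 <= d by exact: mdist_ge0.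
(* any parameter strictly between [a + s] and [c - d] would do *)
pose e := (a + s + (c - d)) / 2.
have xm : U e (x_ m) by apply: IH; [exact: ltnW | rewrite -/s /e; lra..].
apply: (Uthick e c); [rewrite /e; lra.. |].
apply/set_dist_ltP; exists (phi (t_ m) (x_ m)).
  by apply: Uinv => //; [apply/andP; split; rewrite /e; lra | exact: tM].
by rewrite metric_sym -/d /e; lra.
Qed.

(** * Chain reachable points lie in the stable sets *)

(** The chain is tracked between the parameters [eta / 2] and [eta], a compact
    range on which the return times of the family have a common bound [M].
    Flow times larger than [M + S] moreover place the source of the last jump
    in the image of [U eta] after time [S]. *)
Lemma chain_reach_bar_stable (Y B : set X) :
  compact [set: X] -> strongly_stable phi B -> omega_limit phi Y `<=` B ->
  chain_reach_bar phi Y `<=` B.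
Proof.
move=> hX [_ [rho [U [t [_ Unbhs Umono [_ tbnd] [Uthick BE Uinv]]]]]] YB x xY.
rewrite BE => eta /=; rewrite in_itv /= => /andP[eta0 eta_rho] S /= S0.
(* delay after which the orbits of [Y] are in the smallest tracked set *)
have [|T0 T00 YU] := @omega_limit_absorb Y (U (eta / 2)) hX.
  move=> y /YB yB; have [|_] := Unbhs (eta / 2); first by apply/andP; lra.
  exact.
have [||M M0 tM] := pinfty_ex_gt0 (tbnd `[eta / 2, eta]%classic _ _).
- exact: segment_compact.
- by move=> e /=; rewrite !in_itv /= => /andP[? ?]; apply/andP; split; lra.
have phiU c s z : eta / 2 <= c <= eta -> M + S <= s -> U c z -> U c (phi s z).
  move=> /andP[c1 c2] Ms Ucz.
  apply: (Uinv c); first by apply/andP; split; lra.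
  apply: subset_closure; exists s; last by exists z.
  rewrite /= in_itv /= andbT.
  have /= : `|t c| <= M by apply: tM; rewrite /= in_itv /= c1 c2.
  by rewrite ler_norml => /andP[_]; lra.
apply/closure_mdistP => d d0.
have eps0 : 0 < Num.min d (eta / 2) by rewrite lt_min d0 /=; lra.
have T1 : 0 < T0 + (M + S) by lra.
have [y Yy /(strong_chain_delay T00)] := xY _ _ eps0 T1.
move=> [[|n] [x_ [t_ []]]] // _ tT x0 xn.
rewrite lt_min => /andP[sum_d sum_eta].
have sum0 m : 0 <= \sum_(i < m) mdist (phi (t_ i) (x_ i)) (x_ i.+1).
  by apply: sumr_ge0 => i _; exact: mdist_ge0.
exists (phi (t_ n) (x_ n)); last first.
  rewrite -xn metric_sym; move: sum_d; rewrite big_ord_recr /=.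
  by have := sum0 n; lra.
exists (t_ n); first by rewrite /= in_itv /= andbT; have := tT n (ltnSn n); lra.
exists (x_ n) => //.
apply: (@chain_tracking U (eta / 2) eta (M + S) n.+1 x_ t_) => //.
- by move=> c e ? ? ?; apply: Umono; lra.
- by move=> c e z ? ? ? zU; apply: (Uthick c e) => //; lra.
- by rewrite x0; exact: YU.
- move: sum_eta; rewrite big_ord_recr /=.
  by have := mdist_ge0 (phi (t_ n) (x_ n)) (x_ n.+1); lra.
Qed.

(** * The stable sets generated by strong chains *)

Lemma chain_reach_flow (Y : set X) (eps T t : R) (x : X) :
  T <= t -> chain_reach phi Y eps T x -> chain_reach phi Y eps T (phi t x).
Proof. by move=> Tt [y Yy yx]; exists y => //; exact: strong_chain_flow. Qed.

(** The cost of a chain absorbs a displacement of its endpoint, and the strict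
    inequality [mdist x z < d] leaves room for replacing [x] by a reachable
    point close to it.  This one estimate gives the thickening axiom, the
    neighborhood property and the inclusion of [reach_core] in the reachable
    sets. *)
Lemma chain_reach_thicken (Y : set X) (eps d T : R) (x z : X) :
  closure (chain_reach phi Y eps T) x -> mdist x z < d ->
  chain_reach phi Y (eps + d) T z.
Proof.
move=> /closure_mdistP clx xz.
have [|a [y Yy ya] xa] := clx (d - mdist x z); first by lra.
exists y => //; apply: strong_chain_move ya _.
by have := metric_triangle a x z; rewrite (metric_sym a x); lra.
Qed.

Definition reach_core (Y : set X) (T : R) : set X :=
  \bigcap_(eta in `]0, 1[%classic)
    omega_limit phi (closure (chain_reach phi Y eta T)).

Lemma closure_chain_reach_invariant (Y : set X) (eps T : R) :
  closure (flow_image phi `[T, +oo[%classic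
    (closure (chain_reach phi Y eps T))) `<=` closure (chain_reach phi Y eps T).
Proof.
move=> x clx; apply: closed_closure.
apply: (closureS _ clx) => _ [t /= + [a aY <-]].
rewrite in_itv /= andbT => Tt.
by apply: closure_flow aY => b; exact: chain_reach_flow.
Qed.

Lemma reach_core_sub (Y : set X) (eta T : R) :
  0 <= T -> 0 < eta < 1 ->
  reach_core Y T `<=` closure (chain_reach phi Y eta T).
Proof.
move=> T0 eta01 x xC; apply: closure_chain_reach_invariant.
by apply: (xC eta) => //=; rewrite in_itv.
Qed.

Lemma reach_core_chain_reach (Y : set X) (eps T : R) :
  0 < eps -> 0 <= T -> reach_core Y T `<=` chain_reach phi Y eps T.
Proof.
move=> eps0 T0 x xC.
pose eta := Num.min (eps / 2) (1 / 2).
have eta_gt0 : 0 < eta by rewrite lt_min; apply/andP; split; lra.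
have eta_lt1 : eta < 1 by rewrite gt_min; apply/orP; right; lra.
have eta_eps : eta < eps by rewrite gt_min; apply/orP; left; lra.
rewrite -[eps](subrKC eta); apply: (@chain_reach_thicken _ _ _ _ x).
  by apply: reach_core_sub xC => //; apply/andP.
by rewrite mdistxx subr_gt0.
Qed.

Lemma omega_limit_sub_reach_core (Y : set X) (T : R) :
  0 <= T -> omega_limit phi Y `<=` reach_core Y T.
Proof.
move=> T0 x xY eta /=; rewrite in_itv /= => /andP[eta0 _].
apply: (omega_limit_delay T0 _ xY) => y Yy.
by apply: subset_closure; exists y => //; exact: strong_chain_orbit.
Qed.

(** The constant return time [T] works for every parameter.  The upper end [1]
    of the parameter range is arbitrary. *)
Lemma strongly_stable_reach_core (Y : set X) (T : R) :
  0 < T -> strongly_stable phi (reach_core Y T).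
Proof.
move=> T0; split.
  apply: closed_bigI => eta _; apply: closed_bigI => S _.
  exact: closed_closure.
exists 1, (fun eta => closure (chain_reach phi Y eta T)), (fun=> T).
split=> //.
- move=> eta /andP[eta0 eta1]; split; first exact: closed_closure.
  move=> x xC; apply/nbhs_ballP; exists (eta / 2) => /=; first by lra.
  move=> z; rewrite ballEmdist /= => xz; apply: subset_closure.
  rewrite [eta]splitr; apply: chain_reach_thicken xz.
  by apply: reach_core_sub xC; [exact: ltW | apply/andP; split; lra].
- move=> a b a0 ab b1; apply: closureS => x [y Yy yx].
  by exists y => //; apply: strong_chain_weaken yx; exact: ltW.
- split=> [eta _|K _ _]; [exact: T0 | exact: bounded_cst].
split=> //.
- move=> a b a0 ab b1 x /= /set_dist_ltP[z zU xz].
  apply: subset_closure; rewrite -[b](subrKC a).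
  by apply: chain_reach_thicken zU _; rewrite metric_sym.
- by move=> eta _; exact: closure_chain_reach_invariant.
Qed.

End Flow.

Theorem theorem1 (R : realType) (X : metricType R) (phi : R -> X -> X)
    (hX : compact [set: X]) (hphi : continuous_flow phi)
    (Y : set X) (hY : closed Y) :
  chain_reach_bar phi Y =
  \bigcap_(B in [set B : set X |
      strongly_stable phi B /\ omega_limit phi Y `<=` B]) B.
Proof.
apply/seteqP; split=> x xY.
  by move=> B /= [stB YB]; exact: (chain_reach_bar_stable hphi hX stB YB).
move=> eps T eps0 T0; apply: reach_core_chain_reach (ltW T0) _ _ => //.
apply: xY; split; first exact: strongly_stable_reach_core.
by apply: omega_limit_sub_reach_core => //; exact: ltW.
Qed.
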